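(* Let $\mathbb{D}\subseteq\mathbb{R}$ be a subset such that $1-t\in\mathbb{D}$ whenever $t\in\mathbb{D}$, and let $f:\mathbb{D}\to[0,\infty)$ be a mapping such that $f(t)+f(1-t)=1$ for all $t\in\mathbb{D}$. Let $\mathscr{A}$ be a unital $C^*$-algebra, let $\mathscr{X}$ be a pre-Hilbert $\mathscr{A}$-module and let $\varphi$ be a positive linear functional on $\mathscr{A}$. Let $n\geq 2$ and let $x_1,x_2,\ldots,x_n,z\in\mathscr{X}$ be such that $\varphi(|z|^2)=1$. Then for any $\xi\in\mathbb{D}$ and any $\alpha\in\mathbb{C}\setminus\{0\}$, $$\left|\prod_{i=1}^{n}\varphi(\langle x_i,z\rangle)\right|^2\leq \frac{\max\{1,|\alpha-1|^2\}}{|\alpha|^2}\prod_{i=1}^{n}\varphi(|x_i|^2)+\frac{f(1-\xi)}{|\alpha|^2}\left|\varphi(\langle x_1,x_2\rangle)\prod_{i=3}^{n}\varphi(\langle x_i,z\rangle)\right|^2+\frac{f(\xi)+2\max\{1,|\alpha-1|\}}{|\alpha|^2}\prod_{i=1}^{n}\sqrt{\varphi(|x_i|^2)}\left|\varphi(\langle x_1,x_2\rangle)\prod_{i=3}^{n}\varphi(\langle x_i,z\rangle)\right|.$$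
   Context: A pre-Hilbert $\mathscr{A}$-module $\mathscr{X}$ is a complex vector space that is a (right) $\mathscr{A}$-module with an $\mathscr{A}$-valued inner product $\langle\cdot,\cdot\rangle:\mathscr{X}\times\mathscr{X}\to\mathscr{A}$, linear in the second variable and conjugate-linear in the first, with $\langle x,ya\rangle=\langle x,y\rangle a$, $\langle x,y\rangle^*=\langle y,x\rangle$, $\langle x,x\rangle\geq 0$, and $\langle x,x\rangle=0$ only if $x=0$. For $x\in\mathscr{X}$, $|x|^2$ denotes $\langle x,x\rangle\in\mathscr{A}$. An empty product (such as $\prod_{i=3}^{n}$ when $n=2$) equals $1$. *)

(* Defs.v *)
From HB Require Import structures.
From mathcomp Require Import all_boot all_order all_algebra.
From mathcomp Require Import all_classical all_reals all_analysis.
From mathcomp Require Import complex.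

Set Implicit Arguments.
Unset Strict Implicit.
Unset Printing Implicit Defensive.

Import Order.TTheory GRing.Theory Num.Theory.
Import numFieldNormedType.Exports.

Local Open Scope classical_set_scope.
Local Open Scope ring_scope.
Local Open Scope complex_scope.

(* The norm cnorm is a field of the mixin because the library hierarchies
   admit no type that is both an algType and a normedModType, unless it is a
   numDomainType. The ring structure underlying algType makes the algebra
   unital with 1 != 0. *)
HB.mixin Record isCStarAlgebra (R : realType) A & GRing.Algebra R[i] A := {
  star : A -> A ;
  starK : involutive star ;
  starD : {morph star : a b / a + b} ;
  starZ : forall (c : R[i]) (a : A), star (c *: a) = Num.conj c *: star a ;
  starM : forall a b : A, star (a * b) = star b * star a ;
  cnorm : A -> R ;
  cnorm_triangle : forall a b : A, cnorm (a + b) <= cnorm a + cnorm b ;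
  cnormZ : forall (c : R[i]) (a : A),
    cnorm (c *: a) = complex.Re `|c| * cnorm a ;
  cnorm_eq0 : forall a : A, cnorm a = 0 -> a = 0 ;
  cnorm_complete : forall u : nat -> A,
    (forall e : R, 0 < e -> exists N : nat, forall p q : nat,
      (N <= p)%N -> (N <= q)%N -> cnorm (u p - u q) < e) ->
    exists l : A, (fun k : nat => cnorm (u k - l)) @ \oo --> (0 : R) ;
  cnormM_le : forall a b : A, cnorm (a * b) <= cnorm a * cnorm b ;
  cnorm_starM : forall a : A, cnorm (star a * a) = cnorm a ^+ 2
}.

#[short(type="cstarAlgType")]
HB.structure Definition CStarAlgebra (R : realType) :=
  {A of GRing.Algebra R[i] A & isCStarAlgebra R A}.

Section Positivity.
Variables (R : realType) (A : cstarAlgType R).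

Definition invertible (a : A) : Prop := exists b : A, a * b = 1 /\ b * a = 1.

Definition spectrum (a : A) : set R[i] :=
  [set l | ~ invertible (l%:A - a)].

Definition positive_elt (a : A) : Prop :=
  star a = a /\ spectrum a `<=` [set l | 0 <= l].

Definition positive_functional (phi : {scalar A}) : Prop :=
  forall a : A, positive_elt a -> 0 <= phi a.

End Positivity.

HB.mixin Record isPreHilbertModule (R : realType) (A : cstarAlgType R) X
    & GRing.Lmodule R[i] X := {
  ract : X -> A -> X ;
  ractDl : forall (x y : X) (a : A), ract (x + y) a = ract x a + ract y a ;
  ractDr : forall (x : X) (a b : A), ract x (a + b) = ract x a + ract x b ;
  ractM : forall (x : X) (a b : A), ract x (a * b) = ract (ract x a) b ;
  ract1 : forall x : X, ract x 1 = x ;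
  ractZl : forall (c : R[i]) (x : X) (a : A),
    ract (c *: x) a = c *: ract x a ;
  ractZr : forall (c : R[i]) (x : X) (a : A),
    ract x (c *: a) = c *: ract x a ;
  inner : X -> X -> A ;
  inner_linearr : forall (x y y' : X) (c : R[i]),
    inner x (c *: y + y') = c *: inner x y + inner x y' ;
  inner_conjlinearl : forall (x x' y : X) (c : R[i]),
    inner (c *: x + x') y = Num.conj c *: inner x y + inner x' y ;
  inner_ract : forall (x y : X) (a : A), inner x (ract y a) = inner x y * a ;
  star_inner : forall x y : X, star (inner x y) = inner y x ;
  inner_ge0 : forall x : X, positive_elt (inner x x) ;
  inner_eq0 : forall x : X, inner x x = 0 -> x = 0
}.

#[short(type="preHilbertModType")]
HB.structure Definition PreHilbertModule (R : realType) (A : cstarAlgType R) :=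
  {X of GRing.Lmodule R[i] X & isPreHilbertModule R A X}.

Notation "⟨ x , y ⟩" := (inner x y)
  (at level 0, x at level 99, y at level 99, format "⟨ x ,  y ⟩") : ring_scope.

Definition sqabs (R : realType) (A : cstarAlgType R)
  (X : preHilbertModType A) (x : X) : A := ⟨x, x⟩.

(* Main.v *)
Require Import Defs.
From mathcomp Require Import all_boot all_order all_algebra.
From mathcomp Require Import all_classical all_reals all_analysis.
From mathcomp Require Import complex.
From mathcomp Require Import ring.

Import Order.TTheory GRing.Theory Num.Theory.

Local Open Scope ring_scope.
Local Open Scope complex_scope.

(** Why the theorem holds.  The map [B = ((x, y) |-> phi ⟨x, y⟩)] is a possibly
    degenerate complex semi-inner product on [X], in which [z] is a unit
    vector, so the inequality is one about such forms.

    Write [|y|] for the seminorm of a vector [y] and let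
    [M = max {1, |alpha - 1|}].  The operator [b |-> (alpha * B z b) *: z - b]
    is [alpha] times the orthogonal projection onto the line of [z], minus the
    identity.  It acts as [alpha - 1] on that line and as [-1] on its
    orthogonal complement, so it stretches seminorms by a factor of at most [M]
    ([scaled_projection_sub_le]).  Cauchy-Schwarz turns this into an inequality
    of Buzano type ([buzano]),
      [|alpha B(x_1, z) B(z, x_2) - B(x_1, x_2)| <= M |x_1| |x_2|].

    Let [P = |B(x_1, z) ... B(x_n, z)|], [N = |x_1| ... |x_n|] and
    [T = |B(x_1, x_2) B(x_3, z) ... B(x_n, z)|].  The triangle inequality,
    multiplied by the factors [|B(x_i, z)|] with [i >= 3] (each at most
    [|x_i|] by Cauchy-Schwarz), gives [|alpha| P <= M N + T], and likewise
    [T <= N].  Squaring leaves [M^2 N^2 + 2 M N T + T^2].  The weights [f xi]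
    and [f (1 - xi)] sum to 1 and split [T^2]; the [f xi] part is weakened to
    [N T], which is the stated bound ([weighted_square_bound]). *)

(** * Semi-inner products *)

(** The form may vanish on nonzero vectors, as [phi] may vanish on nonzero
    positive elements.  Hermitian symmetry follows from these fields, see
    [semi_innerC]. *)
Record semi_inner {C : numClosedFieldType} {V : lmodType C}
    (B : V -> V -> C) : Prop := SemiInner {
  semi_innerPr : forall c u v w, B u (c *: v + w) = c * B u v + B u w ;
  semi_innerPl : forall c u v w, B (c *: u + v) w = Num.conj c * B u w + B v w ;
  semi_inner_ge0 : forall u, 0 <= B u u
}.

Arguments semi_innerPr {C V B} _.
Arguments semi_innerPl {C V B} _.
Arguments semi_inner_ge0 {C V B} _.

Section SemiInnerTheory.
Context {C : numClosedFieldType} {V : lmodType C} {B : V -> V -> C}.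
Context (HB : semi_inner B).

Lemma semi_inner_expand c u v :
  B (c *: u + v) (c *: u + v) =
    `|c| ^+ 2 * B u u + Num.conj c * B u v + c * B v u + B v v.
Proof.
by rewrite (semi_innerPl HB) !(semi_innerPr HB) normCK; ring.
Qed.

(** Polarization: [B (u + v) (u + v)] and [B ('i u + v) ('i u + v)] are real,
    which determines the real and the imaginary part of [B u v - (B v u)^*]. *)
Lemma semi_innerC u v : Num.conj (B u v) = B v u.
Proof.
have real_conj w : Num.conj (B w w) = B w w.
  by apply/CrealP/ger0_real/(semi_inner_ge0 HB).
have cross c : Num.conj (Num.conj c * B u v + c * B v u)
    = Num.conj c * B u v + c * B v u.
  have -> : Num.conj c * B u v + c * B v u
      = B (c *: u + v) (c *: u + v) - `|c| ^+ 2 * B u u - B v v.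
    by rewrite semi_inner_expand; ring.
  by rewrite !rmorphB !rmorphM /= !real_conj !conj_normC.
have := cross 'i%R; have := cross 1.
rewrite !rmorphD !rmorphM /= !conjCK !rmorph1 !conjCi.
set p := B u v; set q := B v u; set p' := Num.conj p; set q' := Num.conj q.
rewrite !mul1r => E1 E2.
have {}E2 : p' - q' = q - p.
  apply: (mulfI (neq0Ci C)); transitivity ('i%R * p' + - 'i%R * q'); first by ring.
  by rewrite E2; ring.
apply: (mulIf (x := 2)); first by rewrite pnatr_eq0.
have -> : p' * 2 = (p' + q') + (p' - q') by ring.
by rewrite E1 E2; ring.
Qed.

Lemma norm_semi_innerC u v : `|B u v| = `|B v u|.
Proof. by rewrite -semi_innerC norm_conjC. Qed.

(** Over a degenerate form the usual minimizing coefficient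
    [- B v u / B v v] need not exist, hence the case analysis: when both
    seminorms vanish, the coefficient [- B v u] already forces
    [- 2 |B u v|^2 >= 0]. *)
Lemma cauchy_schwarz_sq u v : `|B u v| ^+ 2 <= B u u * B v v.
Proof.
have nondeg a b : B b b != 0 -> `|B a b| ^+ 2 <= B a a * B b b.
  move=> bb; have bb_gt0 : 0 < B b b by rewrite lt0r bb (semi_inner_ge0 HB).
  have := semi_inner_ge0 HB ((- (B b a / B b b)) *: b + a).
  rewrite semi_inner_expand !normCK !rmorphN !rmorphM /= fmorphV /=.
  rewrite !semi_innerC => h; rewrite -subr_ge0.
  by have := mulr_ge0 h (ltW bb_gt0); congr (0 <= _); field.
have [vv|] := eqVneq (B v v) 0; last exact: nondeg.
have [uu|uu] := eqVneq (B u u) 0; last first.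
  by rewrite norm_semi_innerC mulrC; exact: nondeg.
have := semi_inner_ge0 HB ((- B v u) *: v + u).
rewrite semi_inner_expand vv uu rmorphN /= semi_innerC !mulr0 add0r addr0.
rewrite normCK semi_innerC.
have -> : - B u v * B v u + - B v u * B u v = - (B u v * B v u * 2) by ring.
by rewrite oppr_ge0 pmulr_lle0.
Qed.

Lemma cauchy_schwarz u v : `|B u v| <= sqrtC (B u u) * sqrtC (B v v).
Proof.
rewrite -sqrtCM ?nnegrE ?(semi_inner_ge0 HB) //.
rewrite -(@ler_pXn2r _ 2) ?nnegrE ?sqrtC_ge0 //.
  by rewrite sqrtCK; exact: cauchy_schwarz_sq.
by rewrite mulr_ge0 ?(semi_inner_ge0 HB).
Qed.

Lemma norm_semi_inner_unit z v : B z z = 1 -> `|B v z| <= sqrtC (B v v).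
Proof. by move=> z1; have := cauchy_schwarz v z; rewrite z1 sqrtC1 mulr1. Qed.

(** With [beta = B z b], Pythagoras for the decomposition of [b] along the
    unit vector [z] reads
    [B w w = |alpha - 1|^2 |beta|^2 + (B b b - |beta|^2)], and the
    coefficients [|alpha - 1|^2] and [1] are both at most [M^2]. *)
Lemma scaled_projection_sub_le alpha M z b w : B z z = 1 ->
    1 <= M -> `|alpha - 1| <= M -> w = (- (alpha * B z b)) *: z + b ->
  B w w <= M ^+ 2 * B b b.
Proof.
move=> z1 M1 Ma ->{w}; set w := _ + b.
have beta_le : `|B z b| ^+ 2 <= B b b.
  by have := cauchy_schwarz_sq z b; rewrite z1 mul1r.
have M2 : 1 <= M ^+ 2 by rewrite exprn_ege1.
have Ma2 : `|alpha - 1| ^+ 2 <= M ^+ 2.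
  by rewrite ler_pXn2r ?nnegrE // (le_trans ler01).
have -> : B w w =
    `|alpha - 1| ^+ 2 * `|B z b| ^+ 2 + (B b b - `|B z b| ^+ 2).
  rewrite /w semi_inner_expand z1 !normCK !rmorphN !rmorphM !rmorphB rmorph1 /=.
  by rewrite semi_innerC; ring.
have -> : M ^+ 2 * B b b =
    M ^+ 2 * `|B z b| ^+ 2 + M ^+ 2 * (B b b - `|B z b| ^+ 2) by ring.
by rewrite lerD ?ler_wpM2r ?exprn_ge0 // ler_peMl ?subr_ge0.
Qed.

(** Cauchy-Schwarz for [a] and the vector [w] of [scaled_projection_sub_le]. *)
Lemma buzano alpha M z a b : B z z = 1 ->
    1 <= M -> `|alpha - 1| <= M ->
  `|alpha * B a z * B z b - B a b| <= M * (sqrtC (B a a) * sqrtC (B b b)).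
Proof.
move=> z1 M1 Ma; have M0 : 0 <= M by exact: le_trans M1.
pose w := (- (alpha * B z b)) *: z + b.
have w_le := scaled_projection_sub_le alpha M z b w z1 M1 Ma (erefl w).
have -> : alpha * B a z * B z b - B a b = - B a w.
  by rewrite /w (semi_innerPr HB); ring.
rewrite normrN (le_trans (cauchy_schwarz a w)) // mulrCA ler_wpM2l //.
  by rewrite sqrtC_ge0 (semi_inner_ge0 HB).
rewrite -[M]sqrCK // -sqrtCM ?nnegrE ?exprn_ge0 ?(semi_inner_ge0 HB) //.
by rewrite ler_sqrtC ?nnegrE ?mulr_ge0 ?exprn_ge0 ?(semi_inner_ge0 HB).
Qed.

Lemma buzano_norm alpha M z a b : B z z = 1 ->
    1 <= M -> `|alpha - 1| <= M ->
  `|alpha| * (`|B a z| * `|B b z|) <=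
    M * (sqrtC (B a a) * sqrtC (B b b)) + `|B a b|.
Proof.
move=> z1 M1 Ma; rewrite -lerBlDr (le_trans _ (buzano alpha M z a b z1 M1 Ma)) //.
by rewrite (norm_semi_innerC b z) mulrA -!normrM lerB_dist.
Qed.

End SemiInnerTheory.

Lemma semi_inner_functional (R : realType) (A : cstarAlgType R)
    (X : preHilbertModType A) (phi : {scalar A}) :
  positive_functional phi -> semi_inner (fun x y : X => phi ⟨x, y⟩).
Proof.
move=> phi_pos; split=> [c u v w|c u v w|u].
- by rewrite inner_linearr linearP.
- by rewrite inner_conjlinearl linearP.
- exact/phi_pos/inner_ge0.
Qed.

(** * The squared bound *)

(** Multiplied by [k ^+ 2], the right-hand side exceeds [(M * N + T) ^+ 2] by
    exactly [h * T * (N - T)]: this is the cost of replacing the share [h] of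
    [T ^+ 2] by the same share of [N * T]. *)
Lemma weighted_square_bound (F : numFieldType) (k M N T P g h : F) :
    0 < k -> 0 <= P -> 0 <= T -> 0 <= h -> g + h = 1 ->
    k * P <= M * N + T -> T <= N ->
  P ^+ 2 <= M ^+ 2 / k ^+ 2 * N ^+ 2 + g / k ^+ 2 * T ^+ 2
    + (h + 2 * M) / k ^+ 2 * N * T.
Proof.
move=> k0 P0 T0 h0 /(canRL (addrK h)) -> kP TN.
have k_neq0 : k != 0 by rewrite gt_eqF.
rewrite -(ler_pM2l (exprn_gt0 2 k0)) -exprMn.
have -> : k ^+ 2 * (M ^+ 2 / k ^+ 2 * N ^+ 2 + (1 - h) / k ^+ 2 * T ^+ 2
    + (h + 2 * M) / k ^+ 2 * N * T) = (M * N + T) ^+ 2 + h * T * (N - T).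
  by field.
rewrite -[leLHS]addr0 lerD ?mulr_ge0 ?subr_ge0 //.
have kP0 : 0 <= k * P by rewrite mulr_ge0 ?(ltW k0).
by rewrite ler_pXn2r ?nnegrE // (le_trans kP0).
Qed.

Lemma max1_sqr (F : numDomainType) (r : F) :
  0 <= r -> Num.max 1 (r ^+ 2) = Num.max 1 r ^+ 2.
Proof.
by move=> r0; rewrite /Order.max expr_gt1 //; case: ifP; rewrite ?expr1n.
Qed.

(** * The inequality *)

Theorem theorem2p1 (R : realType) (D : set R) (f : R -> R)
  (D_sym : forall t, D t -> D (1 - t))
  (f_ge0 : forall t, D t -> 0 <= f t)
  (f_sum : forall t, D t -> f t + f (1 - t) = 1)
  (A : cstarAlgType R) (X : preHilbertModType A)
  (phi : {scalar A}) (phi_pos : positive_functional phi)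
  (n : nat) (n_ge2 : (2 <= n)%N) (x : nat -> X) (z : X)
  (phi_z : phi (sqabs z) = 1)
  (xi : R) (D_xi : D xi) (alpha : R[i]) (alpha_neq0 : alpha != 0) :
  `|\prod_(1 <= i < n.+1) phi ⟨x i, z⟩| ^+ 2 <=
    Num.max 1 (`|alpha - 1| ^+ 2) / `|alpha| ^+ 2
      * \prod_(1 <= i < n.+1) phi (sqabs (x i))
    + (f (1 - xi))%:C / `|alpha| ^+ 2
      * `|phi ⟨x 1%N, x 2%N⟩ * \prod_(3 <= i < n.+1) phi ⟨x i, z⟩| ^+ 2
    + ((f xi)%:C + 2 * Num.max 1 `|alpha - 1|) / `|alpha| ^+ 2
      * \prod_(1 <= i < n.+1) sqrtC (phi (sqabs (x i)))
      * `|phi ⟨x 1%N, x 2%N⟩ * \prod_(3 <= i < n.+1) phi ⟨x i, z⟩|.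
Proof.
have hB := @semi_inner_functional R A X phi phi_pos.
set B := (fun x y : X => phi ⟨x, y⟩) in hB.
pose M : R[i] := Num.max 1 `|alpha - 1|.
have real1 : (1 : R[i]) \is Num.real by exact: real1.
have M1 : 1 <= M by rewrite comparable_le_max ?lexx // real_comparable.
have Ma : `|alpha - 1| <= M.
  by rewrite comparable_le_max ?lexx ?orbT // real_comparable ?normr_real.
pose s i := sqrtC (phi (sqabs (x i))).
have s0 i : 0 <= s i by rewrite sqrtC_ge0; exact: (semi_inner_ge0 hB).
have sz i : `|phi ⟨x i, z⟩| <= s i by exact: (norm_semi_inner_unit hB z (x i) phi_z).
have split12 (G : nat -> R[i]) : \prod_(1 <= i < n.+1) G i
    = G 1%N * G 2%N * \prod_(3 <= i < n.+1) G i.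
  by rewrite (big_ltn (m := 1)) ?ltnS 1?ltnW // (big_ltn (m := 2)) // mulrA.
pose Q := \prod_(3 <= i < n.+1) `|phi ⟨x i, z⟩|.
have Q0 : 0 <= Q by apply: prodr_ge0.
have Qs : Q <= \prod_(3 <= i < n.+1) s i by apply: ler_prod => i _; rewrite sz normr_ge0.
have -> : \prod_(1 <= i < n.+1) phi (sqabs (x i))
    = (\prod_(1 <= i < n.+1) s i) ^+ 2.
  by rewrite -prodrXl; apply: eq_bigr => i _; rewrite sqrtCK.
rewrite max1_sqr //; apply: weighted_square_bound => //.
- by rewrite normr_gt0.
- by rewrite lecR f_ge0.
- by rewrite -rmorphD /= addrC f_sum.
- rewrite split12 split12 !normrM !normr_prod -/Q.
  (* The tail [Q] is traded for the tail of seminorms in the first term. *)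
  apply: (le_trans (y := (M * (s 1%N * s 2%N) + `|phi ⟨x 1%N, x 2%N⟩|) * Q)).
    rewrite mulrA ler_wpM2r //.
    exact: (buzano_norm hB alpha M z (x 1%N) (x 2%N) phi_z M1 Ma).
  rewrite mulrDl lerD2r -!mulrA ler_wpM2l ?(le_trans ler01) //.
  by rewrite !ler_wpM2l.
- rewrite split12 normrM normr_prod -/Q; apply: ler_pM => //.
  exact: (cauchy_schwarz hB).
Qed.
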